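(* For every $\beta \in [0,1]$, we have $r_2(\beta) \le 1-\frac{1}{2}\beta(1-\beta)$ and $r_3(\beta) \le 1-\frac{1}{3}\beta(1-\beta)$.
   Context: For a complex number $\beta$ with $|\beta|\le 1$, $S(\beta)$ denotes the set of polynomials of degree at least $2$ with complex coefficients, having all their roots in the closed unit disk $\{z\in\mathbb{C}: |z|\le 1\}$ and at least one root at $\beta$. For a polynomial $P$ (of degree at least $2$), $d(P,\beta)$ denotes the distance between $\beta$ and the closest root of the derivative $P'$, i.e. $d(P,\beta)=\min\{|\beta-\zeta| : P'(\zeta)=0\}$. For an integer $n\ge 2$, $r_n(\beta)=\sup\{d(P,\beta) : P\in S(\beta),\ \deg P=n\}$. *)

(* Defs.v *)
From mathcomp Require Import all_boot all_order all_algebra.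
From mathcomp Require Import all_classical all_reals ereal.
From mathcomp Require Export complex.

Set Implicit Arguments.
Unset Strict Implicit.
Unset Printing Implicit Defensive.

Import Order.TTheory GRing.Theory Num.Theory.
Import ComplexField.Normc.

Local Open Scope classical_set_scope.
Local Open Scope ring_scope.
Local Open Scope complex_scope.

(* [2 < size P] says that P has degree at least 2. *)
Definition Sendov_set (R : realType) (beta : R[i]) : set {poly R[i]} :=
  [set P : {poly R[i]} | [/\ (2 < size P)%N, forall z, root P z -> normc z <= 1
            & root P beta]].

(* Infimum of distances; if deg P >= 2 it is attained (see crit_distP), hence
   it is the minimum. *)
Definition crit_dist (R : realType) (P : {poly R[i]}) (beta : R[i]) : R :=
  inf [set normc (beta - zeta) | zeta in [set zeta : R[i] | root P^`() zeta]].

Lemma crit_distP (R : realType) (P : {poly R[i]}) (beta : R[i]) :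
  (2 < size P)%N ->
  (exists2 zeta, root P^`() zeta & crit_dist P beta = normc (beta - zeta)) /\
  (forall zeta, root P^`() zeta -> crit_dist P beta <= normc (beta - zeta)).
Proof.
move=> szP.
have szP' : (1 < size P^`())%N.
  rewrite ltnNge; apply/negP => /leq_sizeP /(_ (size P).-2).
  rewrite coef_deriv; case E: (size P) szP => [|[|[|k]]] //= _ /(_ isT) /eqP.
  rewrite mulrn_eq0 /= => /eqP lc0.
  by move: (lead_coef_eq0 P); rewrite lead_coefE E /= lc0 eqxx -size_poly_eq0 E.
have P'0 : P^`() != 0 by rewrite -size_poly_gt0 ltnW.
have norm_ge0 (z : R[i]) : 0 <= normc z by case: z => a b /=; exact: sqrtr_ge0.
have [rs Prs] := closed_field_poly_normal P^`().
have rootE z : root P^`() z = (z \in rs).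
  by rewrite Prs rootZ ?lead_coef_eq0 // root_prod_XsubC.
have lb : lbound [set normc (beta - zeta) | zeta in [set z | root P^`() z]] 0.
  by move=> _ [z _ <-].
have le_d zeta : root P^`() zeta -> crit_dist P beta <= normc (beta - zeta).
  by move=> zr; apply: ge_inf; [exists 0 | exists zeta].
split=> //.
have rs_neq : rs != [::].
  apply: contraTneq szP' => rs0.
  by rewrite Prs rs0 big_nil size_scale ?lead_coef_eq0 // size_poly1.
have [z0 z0rs zmin] : exists2 z, z \in rs &
    forall w, w \in rs -> normc (beta - z) <= normc (beta - w).
  elim: rs rs_neq {Prs rootE} => // a [|b s] IH _.
    by exists a; rewrite ?inE // => w; rewrite inE => /eqP ->.
  have [//|z zs zm] := IH.
  have [az|za] := leP (normc (beta - a)) (normc (beta - z)).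
    exists a; first by rewrite inE eqxx.
    by move=> w; rewrite inE => /orP[/eqP -> //|/zm]; apply: le_trans.
  exists z; first by rewrite inE zs orbT.
  by move=> w; rewrite inE => /orP[/eqP ->|/zm //]; apply: ltW.
have z0r : root P^`() z0 by rewrite rootE.
exists z0 => //; apply/eqP; rewrite eq_le le_d //=.
apply: lb_le_inf; first by exists (normc (beta - z0)), z0.
by move=> _ [w wr <-]; apply: zmin; rewrite -rootE.
Qed.

(* The supremum is taken in the extended reals, so that an upper bound on it
   also carries the information that the set of distances is bounded above. *)
Definition sendov_r (R : realType) (n : nat) (beta : R[i]) : \bar R :=
  ereal_sup [set (crit_dist P beta)%:E |
              P in [set P : {poly R[i]} | Sendov_set beta P /\ size P = n.+1]].

(* Main.v *)
(* Both bounds follow from d(P, beta) <= 1 - (1 - beta)/n, which is smaller by (1 - beta)^2/n.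
   For n = 3, shift beta to 0: the other roots a, b and the critical points x, y satisfy
   2(a + b) = 3(x + y) and ab = 3xy.  Weighting |beta + a| <= 1 by |b|^2 and |beta + b| <= 1
   by |a|^2 makes the sum expressible through x and y, and the parallelogram law gives
   |a|^2 + |b|^2 <= 3(|x|^2 + |y|^2); the result is an inequality in |x| and |y| alone. *)
Require Import Defs.
From mathcomp Require Import all_boot all_order all_algebra.
From mathcomp Require Import all_classical all_reals ereal.
From mathcomp Require Import complex ring lra.

Import Order.TTheory GRing.Theory Num.Theory ComplexField.Normc.

Local Open Scope ring_scope.
Local Open Scope complex_scope.

Local Notation Re := complex.Re.
Local Notation Im := complex.Im.

Lemma normc_ge0 (R : rcfType) (z : R[i]) : 0 <= normc z.
Proof. by case: z => a b; exact: sqrtr_ge0. Qed.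

Lemma normcXE (R : rcfType) (z : R[i]) : normc z ^+ 2 = Re z ^+ 2 + Im z ^+ 2.
Proof. by case: z => a b; rewrite sqr_sqrtr // addr_ge0 ?sqr_ge0. Qed.

Lemma normc_le1 (R : rcfType) (z : R[i]) : normc z <= 1 ->
  Re z ^+ 2 + Im z ^+ 2 <= 1.
Proof. by move=> z1; rewrite -normcXE exprn_ile1 ?normc_ge0. Qed.

Lemma normc_Re_ge (R : rcfType) (z : R[i]) : - normc z <= Re z.
Proof.
have := normcXE _ z; have := normc_ge0 _ z; have := sqr_ge0 (Im z); nra.
Qed.

Lemma normc_real (R : rcfType) (t : R) : 0 <= t -> normc t%:C = t.
Proof. by move=> t0; rewrite /= expr0n addr0 sqrtr_sqr ger0_norm. Qed.

Lemma Re_add (R : rcfType) (x y : R[i]) : Re (x + y) = Re x + Re y.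
Proof. by case: x y => [? ?] [? ?]. Qed.

Lemma Im_add (R : rcfType) (x y : R[i]) : Im (x + y) = Im x + Im y.
Proof. by case: x y => [? ?] [? ?]. Qed.

Lemma parallelogram (R : rcfType) (x y : R[i]) :
  normc (x + y) ^+ 2 + normc (x - y) ^+ 2 = 2 * (normc x ^+ 2 + normc y ^+ 2).
Proof. by rewrite !normcXE; case: x y => [? ?] [? ?] /=; ring. Qed.

Section Monic_cubic_critical_points.
Variables (R : rcfType) (a b x y : R[i]).
Hypothesis sumE : 2 * (a + b) = 3 * (x + y).
Hypothesis prodE : a * b = 3 * (x * y).

Lemma normc_prod_critical : normc a * normc b = 3 * (normc x * normc y).
Proof.
by rewrite -!normcM prodE normcM -[3 in LHS](rmorph_nat (real_complex R)) normc_real.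
Qed.

(** The sum hypothesis ties [a + b] to [x + y], and the two hypotheses together express
    [(a - b) ^+ 2] through [x - y] and [x + y]. After the triangle inequality, the parallelogram law
    on each pair leaves only the sums of squared moduli. *)
Lemma sum_sqr_normc_critical :
  normc a ^+ 2 + normc b ^+ 2 <= 3 * (normc x ^+ 2 + normc y ^+ 2).
Proof.
have nat_normc n : normc (n%:R : R[i]) = n%:R.
  by rewrite -(rmorph_nat (real_complex R)) normc_real.
have sum_norm : 4 * normc (a + b) ^+ 2 = 9 * normc (x + y) ^+ 2.
  have /(congr1 (fun z => normc z ^+ 2)) := sumE.
  by rewrite !normcM !nat_normc !exprMn -!natrX.
(* Discriminant identity: [(a - b) ^+ 2 = (a + b) ^+ 2 - 4 * (a * b)], with both terms rewritten in
   [x] and [y]. *)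
have discr : 4 * (a - b) ^+ 2 = 12 * (x - y) ^+ 2 + - (3 * (x + y) ^+ 2).
  transitivity ((2 * (a + b)) ^+ 2 - 16 * (a * b)); first by ring.
  by rewrite sumE prodE; ring.
have diff_norm :
    4 * normc (a - b) ^+ 2 <= 12 * normc (x - y) ^+ 2 + 3 * normc (x + y) ^+ 2.
  have := le_normcD (12 * (x - y) ^+ 2 : Rcomplex R) (- (3 * (x + y) ^+ 2)).
  by rewrite -discr normcN !normcM !nat_normc.
have := parallelogram _ a b; have := parallelogram _ x y.
move: (normc (a + b) ^+ 2) (normc (a - b) ^+ 2) (normc (x + y) ^+ 2)
  (normc (x - y) ^+ 2) sum_norm diff_norm => p q r s; lra.
Qed.

(* Both sides equal 2 Re (a b conj(a + b)). *)
Lemma Re_cross_critical :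
  2 * (normc b ^+ 2 * Re a + normc a ^+ 2 * Re b) =
  9 * (normc y ^+ 2 * Re x + normc x ^+ 2 * Re y).
Proof.
have /(congr1 (@Re R)) := sumE; have /(congr1 (@Im R)) := sumE.
have /(congr1 (@Re R)) := prodE; have /(congr1 (@Im R)) := prodE.
rewrite !normcXE.
have -> : (3 : R[i]) = 3%:C by rewrite rmorph_nat.
have -> : (2 : R[i]) = 2%:C by rewrite rmorph_nat.
case: a b x y => [a1 a2] [b1 b2] [x1 x2] [y1 y2] /=.
rewrite !mul0r !subr0 !addr0 => Ip Rp Is Rs.
transitivity ((a1 * b1 - a2 * b2) * (2 * (a1 + b1))
  + (a1 * b2 + a2 * b1) * (2 * (a2 + b2))); first by ring.
by rewrite Ip Rp Is Rs; ring.
Qed.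

(** With the weights |b|^2 and |a|^2, both quadratic terms become |ab|^2 = 9|xy|^2, and the linear
    terms add up to the left side of [Re_cross_critical]. The conclusion is the weighted sum divided
    by 3. *)
Lemma critical_ineq (beta : R) : 0 <= beta <= 1 ->
  normc (beta%:C + a) <= 1 -> normc (beta%:C + b) <= 1 ->
  6 * (normc x * normc y) ^+ 2
    - 3 * beta * (normc x * normc y) * (normc x + normc y)
  <= (1 - beta ^+ 2) * (normc x ^+ 2 + normc y ^+ 2).
Proof.
move=> /andP[beta0 beta1].
have disk z : normc (beta%:C + z) <= 1 ->
    normc z ^+ 2 + 2 * beta * Re z <= 1 - beta ^+ 2.
  move=> /normc_le1; rewrite normcXE; case: z => [z1 z2] /=; lra.
move=> /disk da /disk db.
have {}da := ler_wpM2l (sqr_ge0 (normc b)) da.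
have {}db := ler_wpM2l (sqr_ge0 (normc a)) db.
have sqr_prod : (normc a * normc b) ^+ 2 = 9 * (normc x * normc y) ^+ 2.
  by rewrite normc_prod_critical; ring.
have cross_lb : - (normc x * normc y * (normc x + normc y)) <=
    normc y ^+ 2 * Re x + normc x ^+ 2 * Re y.
  have := ler_wpM2l (sqr_ge0 (normc y)) (normc_Re_ge _ x).
  have := ler_wpM2l (sqr_ge0 (normc x)) (normc_Re_ge _ y); lra.
have {}cross_lb := ler_wpM2l beta0 cross_lb.
have beta2 : 0 <= 1 - beta ^+ 2 by nra.
have sum_ub := ler_wpM2l beta2 sum_sqr_normc_critical.
have := congr1 ( *%R beta) Re_cross_critical.
move: (normc a) (normc b) (normc x) (normc y) (Re a) (Re b) (Re x) (Re y)
  sqr_prod da db sum_ub cross_lb => A B X Y ra rb rx ry; lra.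
Qed.

(* Dividing [critical_ineq] by (|x| |y|)^2 gives an inequality in 1/|x| and 1/|y|,
   which are at most 1/d: it forces 3 d (d - beta) <= 1 - beta^2. *)
Lemma critical_dist_bound (beta d : R) : 0 <= beta <= 1 ->
  normc (beta%:C + a) <= 1 -> normc (beta%:C + b) <= 1 ->
  d <= normc x -> d <= normc y -> d <= 1 - 3^-1 * (1 - beta).
Proof.
move=> beta01 a1 b1 dx dy; have ineq := critical_ineq _ beta01 a1 b1.
move: beta01 => /andP[beta0 beta1].
rewrite leNgt; apply/negP => d_gt.
have d0 : 0 < d by lra.
move: (normc x) (normc y) dx dy ineq => X Y dX dY ineq.
have W0 : 0 < X * Y by nra.
have W2 : 0 < (X * Y) ^+ 2 by rewrite exprn_gt0.
have beta2 : 0 <= 1 - beta ^+ 2 by nra.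
(* This is 1/X + 1/Y <= 2/d with denominators cleared; [h2] is the analogue for the inverse
   squares. *)
have h1 : d * (X + Y) <= 2 * (X * Y) by nra.
have h2 : d ^+ 2 * (X ^+ 2 + Y ^+ 2) <= 2 * (X * Y) ^+ 2.
  have dX2 : (d * X) ^+ 2 <= (X * Y) ^+ 2 by rewrite ler_sqr ?nnegrE; nra.
  have dY2 : (d * Y) ^+ 2 <= (X * Y) ^+ 2 by rewrite ler_sqr ?nnegrE; nra.
  lra.
have {}h1 : beta * d * (X * Y) * (d * (X + Y)) <= beta * d * (X * Y) * (2 * (X * Y)).
  exact: (ler_wpM2l (mulr_ge0 (mulr_ge0 beta0 (ltW d0)) (ltW W0))).
have {}h2 := ler_wpM2l beta2 h2.
have {}ineq := ler_wpM2l (sqr_ge0 d) ineq.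
have : (3 * d * (d - beta) - (1 - beta ^+ 2)) * (X * Y) ^+ 2 <= 0 by lra.
(* At d = (2 + beta)/3 the difference 3d(d - beta) - (1 - beta^2) equals (1 - beta)^2/3, and it
   increases strictly with d from there on, which contradicts [d_gt]. *)
rewrite pmulr_lle0 //; nra.
Qed.

End Monic_cubic_critical_points.

Lemma poly_split_root (F : closedFieldType) (P : {poly F}) (n : nat) (z : F) :
  size P = n.+2 -> root P z ->
  exists c s, [/\ size s = n, P = c *: \prod_(w <- z :: s) ('X - w%:P)
    & forall w, w \in s -> root P w].
Proof.
move=> szP; have P0 : P != 0 by rewrite -size_poly_gt0 szP.
have [r Pr] := closed_field_poly_normal P.
have rootE w : root P w = (w \in r).
  by rewrite Pr rootZ ?lead_coef_eq0 // root_prod_XsubC.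
rewrite rootE => zr; exists (lead_coef P), (rem z r); split.
- move: szP; rewrite Pr size_scale ?lead_coef_eq0 // size_prod_XsubC => -[szr].
  by rewrite size_rem // szr.
- by rewrite {1}Pr; congr (_ *: _); apply/perm_big/perm_to_rem.
- by move=> w /mem_rem; rewrite rootE.
Qed.

(** Removes the infimum and the supremum: what remains is to bound any common lower bound [d] of the
    critical distances, for an explicitly factored polynomial. The list [s] holds the other roots
    with multiplicity, so it may contain [beta] again. *)
Lemma sendov_r_le (R : realType) (n : nat) (beta : R[i]) (M : R) :
  (forall c (s : seq R[i]) P, size s = n.-1 -> (1 < n)%N ->
     P = c *: \prod_(w <- beta :: s) ('X - w%:P) ->
     (forall w, w \in s -> normc w <= 1) ->
     forall d, (forall z, root P^`() z -> d <= normc (beta - z)) -> d <= M) ->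
  (1 < n)%N -> (sendov_r n beta <= M%:E)%E.
Proof.
move=> bound; case: n bound => [//|n] bound n1.
apply: ge_ereal_sup => _ [P [[szP disk Pbeta] sz] <-]; rewrite lee_fin.
have [c [s [szs PE rs]]] := poly_split_root _ _ _ _ sz Pbeta.
apply: (bound c s P szs n1 PE) => [w /rs /disk //|].
by have [_ crit] := crit_distP beta szP.
Qed.

Theorem theorem2 (R : realType) (beta : R) (hbeta : 0 <= beta <= 1) :
  (sendov_r 2 beta%:C <= (1 - 2^-1 * beta * (1 - beta))%:E)%E /\
  (sendov_r 3 beta%:C <= (1 - 3^-1 * beta * (1 - beta))%:E)%E.
Proof.
have /andP[beta0 beta1] := hbeta.
split; apply: sendov_r_le => // c s P szs _ PE disk d crit.
  case: s szs disk PE => [//|u [|//]] _ disk PE.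
  have u1 : normc u <= 1 by rewrite disk ?inE.
  have P'E z : P^`().[z] = c * (2 * z - beta%:C - u).
    by rewrite PE !big_cons big_nil derivZ !derivE !hornerE /=; ring.
  (* The critical point of a quadratic is the midpoint of its roots, at distance |beta - u|/2 <= (1
     + beta)/2 from [beta]. *)
  have /crit : root P^`() ((beta%:C + u) / 2).
    by apply/rootP; rewrite P'E; field.
  have -> : beta%:C - (beta%:C + u) / 2 = (2^-1)%:C * (beta%:C - u).
    by rewrite fmorphV rmorph_nat; field.
  rewrite normcM normc_real ?invr_ge0 //.
  have := le_normcD (beta%:C : Rcomplex R) (- u).
  rewrite normcN normc_real //; nra.
case: s szs disk PE => [//|u [//|v [|//]]] _ disk PE.
have u1 : normc u <= 1 by rewrite disk ?inE ?eqxx.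
have v1 : normc v <= 1 by rewrite disk ?inE ?eqxx ?orbT.
set a := u - beta%:C; set b := v - beta%:C.
(* A square root of a quarter of the discriminant of [3 * w ^+ 2 - 2 * (a + b) * w + a * b], so that
   the critical points are at [(a + b + s) / 3] and [(a + b - s) / 3] relative to [beta]. *)
set s := sqrtc (a ^+ 2 - a * b + b ^+ 2).
have s2 : s ^+ 2 = a ^+ 2 - a * b + b ^+ 2 by exact: sqr_sqrtc.
have P'E w : P^`().[beta%:C + w] = c * (3 * w ^+ 2 - 2 * (a + b) * w + a * b).
  by rewrite PE !big_cons big_nil derivZ !derivE !hornerE /= /a /b; ring.
have root_dist w : 3 * w ^+ 2 - 2 * (a + b) * w + a * b = 0 -> d <= normc w.
  move=> w0; have /crit : root P^`() (beta%:C + w).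
    by apply/rootP; rewrite P'E w0 mulr0.
  by rewrite opprD addNKr normcN.
(* Only the square of [t] matters, so one computation covers both signs of [s]. *)
have root_sqrt t : t ^+ 2 = s ^+ 2 -> d <= normc ((a + b + t) / 3).
  move=> t2; apply: root_dist.
  transitivity ((t ^+ 2 - s ^+ 2) / 3); last by rewrite t2 subrr mul0r.
  by rewrite s2; field.
have d_le : d <= 1 - 3^-1 * (1 - beta).
  apply: (@critical_dist_bound _ a b ((a + b + s) / 3) ((a + b - s) / 3)) => //.
  - by field.
  - transitivity (((a + b) ^+ 2 - s ^+ 2) / 3); last by field.
    by rewrite s2; field.
  - by rewrite addrC subrK.
  - by rewrite addrC subrK.
  - exact: root_sqrt.
  - by apply: root_sqrt; rewrite sqrrN.
nra.
Qed.
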